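(* Assume the training observable $A:\mathbb{R}\to\mathbb{R}^{N_T}$ is bounded. Then for every $r>0$ there is a constant $C=C(r)>0$ such that for all training observations $\boldsymbol{y}_1,\boldsymbol{y}_2\in\mathbb{R}^{N_T}$ with $\|\boldsymbol{y}_1\|_2,\|\boldsymbol{y}_2\|_2<r$, $$d_{Hell}\left(\mu^{\boldsymbol{y}_1},\mu^{\boldsymbol{y}_2}\right)\le C\,\|\boldsymbol{y}_1-\boldsymbol{y}_2\|_2,$$ where $\|\cdot\|_2$ is the Euclidean norm on $\mathbb{R}^{N_T}$ and $\mu^{\boldsymbol{y}}$ is the posterior distribution on the potential space $W^{\boldsymbol 1}$.
   Context: Fix $\beta>0$ (inverse temperature), $M>0$ (mass), $N_T\in\mathbb{N}$. Loop space: $X=\mathcal{L}\mathbb{R}$ is the space of (continuous) loops $\mathfrak{q}:[0,\beta]\to\mathbb{R}$ with $\mathfrak{q}(0)=\mathfrak{q}(\beta)$. Potential space: $V_o(x)=\frac12x^2$, $\mathring V=V-V_o$, and $W^{\boldsymbol 1}=\{V:\ V-V_o\in L^\infty(\mathbb{R})\cap L^2(\mathbb{R})\}$, normed by $\|V\|_{W^{\boldsymbol 1}}=\|V-V_o\|_{L^2}+\|V-V_o\|_{L^\infty}$ (i.e. $W^{\boldsymbol 1}$ is identified with $L^2\cap L^\infty$ via $V\mapsto V-V_o$). Gibbs measures on loops: $\pi_0$ is the probability measure on $X$ given formally by $\pi_0(d\mathfrak{q})\propto\exp\left(-\int_0^\beta[\frac M2|\dot{\mathfrak{q}}|^2+V_o(\mathfrak{q}(\tau))]d\tau\right)D[\mathfrak{q}]$,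 i.e. the centered Gaussian measure on continuous loops with covariance operator $\left(-M\frac{d^2}{d\tau^2}+1\right)^{-1}$ under periodic boundary conditions on $[0,\beta]$. For $V\in W^{\boldsymbol 1}$, $$\pi^V(d\mathfrak{q})=\frac1{\mathcal{Z}^V}\exp\left(-\int_0^\beta\mathring V(\mathfrak{q}(\tau))\,d\tau\right)\pi_0(d\mathfrak{q}),$$ with $\mathcal{Z}^V$ the normalizing constant. Prior on potentials: the Hermite functions are $\phi_n(x)=(-1)^n(2^nn!\sqrt\pi)^{-1/2}e^{x^2/2}\frac{d^n}{dx^n}e^{-x^2}$. $\mu_0$ is the law on $W^{\boldsymbol 1}$ of $V=V_o+\sum_{i\ge0}\gamma_i\xi_i\phi_i$, with $\xi_i$ i.i.d. $\mathcal{N}(0,1)$ and $\{\gamma_i\}$ a fixed real sequence with $\gamma_i=\mathcal{O}(i^{-s})$, $s>\max\{1,\frac{\theta+2}{4(1-\theta)}\}$ for a fixed $\theta\in(0,1)$. Observables: an observable is a measurable function $A$ of position; for loops $\overline A[\mathfrak{q}]=\frac1\beta\int_0^\beta A(\mathfrak{q}(\tau))d\tau$, and $G^A(V)=\mathbb{E}_{\pi^V}\overline A[\mathfrak{q}]$ (componentwise for vector-valued $A$). Posterior on potentials: $\Gamma_{\boldsymbol\eta}\in\mathbb{R}^{N_T\times N_T}$ is a fixed symmetric positive-definite matrix (noise covariance), $$\Phi(V;\boldsymbol{y})=\tfrac12\left\|\Gamma_{\boldsymbol\eta}^{-1/2}(\boldsymbol{y}-G^A(V))\right\|_2^2-\tfrac12\left\|\Gamma_{\boldsymbol\eta}^{-1/2}\boldsymbol{y}\right\|_2^2,$$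 $$\mu^{\boldsymbol{y}}(dV)=\frac1{Z(\boldsymbol{y})}\exp(-\Phi(V;\boldsymbol{y}))\,\mu_0(dV),\qquad Z(\boldsymbol{y})=\int_{W^{\boldsymbol 1}}\exp(-\Phi(V;\boldsymbol{y}))\mu_0(dV).$$ Hellinger distance: $d_{Hell}(\mu,\mu')=\sqrt{\frac12\int\left(\sqrt{\frac{d\mu}{d\nu}}-\sqrt{\frac{d\mu'}{d\nu}}\right)^2d\nu}$ for any $\nu$ dominating both. *)

(* Defs.v *)
From HB Require Import structures.
From mathcomp Require Import all_boot all_order all_algebra.
From mathcomp Require Import all_classical all_reals all_analysis.
From mathcomp Require Import measurable_realfun ess_sup_inf.

Set Implicit Arguments.
Unset Strict Implicit.
Unset Printing Implicit Defensive.

Import Order.TTheory GRing.Theory Num.Theory.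
Import numFieldNormedType.Exports.

Local Open Scope classical_set_scope.
Local Open Scope ring_scope.

Section LinearAlgebra.
Context {R : realType}.

Definition l2norm n (v : 'cV[R]_n) : R := Num.sqrt (\sum_i v i ord0 ^+ 2).

Definition sym_posdef n (G : 'M[R]_n) : Prop :=
  G^T = G /\ forall x : 'cV[R]_n, x != 0 -> 0 < (x^T *m G *m x) ord0 ord0.

(* G^{-1/2}: for symmetric positive-definite G, the unique symmetric
   positive-definite S with S^2 = G^{-1}. *)
Definition inv_sqrtmx n (G : 'M[R]_n) : 'M[R]_n :=
  xget 0 [set S : 'M[R]_n | sym_posdef S /\ S *m S = invmx G].

End LinearAlgebra.

Section Reweighting.
Context d (T : measurableType d) (R : realType).
Variables (P : probability T R) (h : T -> R).
Local Open Scope ereal_scope.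

(* B |-> \int_B e^{-h} dP. The set function is a measure only when h is
   measurable; it is set to 0 otherwise so that it is a measure for all h. *)
Definition exp_density (B : set T) : \bar R :=
  if `[< measurable_fun [set: T] h >]
  then \int[P]_(x in B) (expR (- h x))%:E else 0.

Let exp_density0 : exp_density set0 = 0.
Proof. by rewrite /exp_density integral_set0; case: ifP. Qed.

Let exp_density_ge0 B : 0 <= exp_density B.
Proof.
rewrite /exp_density; case: ifP => // _.
by apply: integral_ge0 => x _; rewrite lee_fin expR_ge0.
Qed.

Let exp_density_sigma_additive : semi_sigma_additive exp_density.
Proof.
move=> F mF tF mUF; rewrite /exp_density.
have [/asboolP mh|_] := boolP `[< measurable_fun [set: T] h >]; last first.
  under eq_fun do rewrite big1//.
  exact: cvg_cst.
have h_ge0 x : 0 <= (expR (- h x))%:E by rewrite lee_fin expR_ge0.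
have mexp : measurable_fun [set: T] (fun x => (expR (- h x))%:E).
  by apply/measurable_EFinP; apply: measurableT_comp => //; exact: measurableT_comp.
rewrite (ge0_integral_bigcup _ mF (measurable_funTS mexp))//.
apply: is_cvg_ereal_nneg_natsum_cond => n _ _.
exact: integral_ge0.
Qed.

HB.instance Definition _ := isMeasure.Build _ _ _ exp_density
  exp_density0 exp_density_ge0 exp_density_sigma_additive.

(* Z^{-1} e^{-h} dP, with Z = \int e^{-h} dP (P itself if Z is 0 or +oo). *)
Definition reweight : probability T R := mnormalize exp_density P.

End Reweighting.

Section LoopSpace.
Context {R : realType}.

(* Loops [0, beta] -> R are encoded as functions on R that vanish outside
   [0, beta], so that Leibniz equality is equality on [0, beta]. *)
Record loop_fun (beta : R) := LoopFun {
  loop_val :> R -> R ;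
  loop_continuous : {within `[0, beta], continuous loop_val} ;
  loop_closed : loop_val 0 = loop_val beta ;
  loop_outside : forall t, t \notin `[0, beta] -> loop_val t = 0 }.

Variable beta : R.

Let loop0_continuous : {within `[0, beta], continuous (fun _ : R => 0 : R)}.
Proof. by move=> x; exact: cvg_cst. Qed.

Definition loop0 : loop_fun beta :=
  LoopFun loop0_continuous erefl (fun _ _ => erefl).

HB.instance Definition _ := gen_eqMixin (loop_fun beta).
HB.instance Definition _ := gen_choiceMixin (loop_fun beta).
HB.instance Definition _ := isPointed.Build (loop_fun beta) loop0.

Definition loop_cylinder : set (set (loop_fun beta)) :=
  \bigcup_(t in `[0, beta])
    preimage_set_system setT (fun q : loop_fun beta => loop_val q t) measurable.

(* The sigma-algebra generated by the evaluations, which is also the Borel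
   sigma-algebra of the uniform norm. *)
Definition loop := g_sigma_algebraType loop_cylinder.

End LoopSpace.
Arguments loop {R} beta.

Section LoopMeasures.
Context {R : realType}.
Variables (beta M : R).

Definition centered_gaussian_law (sigma : R) : set R -> \bar R :=
  if sigma == 0 then dirac (0 : R) else normal_prob 0 sigma.

Definition centered_gaussian_loop (P : probability (loop beta) R) : Prop :=
  forall n (a t : 'I_n -> R), (forall i, t i \in `[0, beta]) ->
  exists sigma : R, forall B : set R, measurable B ->
    P [set q : loop beta | B (\sum_i a i * loop_val q (t i))]
    = centered_gaussian_law sigma B.

Definition covariance_op (P : probability (loop beta) R) (f : R -> R) (t : R)
    : R :=
  \int[lebesgue_measure]_(s in `[0, beta])
    (fine (covariance P (fun q : loop beta => loop_val q t)
                        (fun q : loop beta => loop_val q s)) * f s).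

Definition periodic (f : R -> R) : Prop := forall t, f (t + beta) = f t.

Definition solves_ode (f u : R -> R) : Prop :=
  forall t, [/\ derivable u t 1, derivable u^`()%classic t 1 &
    - M * u^`(2)%classic t + u t = f t].

(* The covariance operator is the inverse of - M d^2/dtau^2 + 1 with periodic
   boundary conditions. Functions with periodic boundary conditions on
   [0, beta] are written as beta-periodic functions on R; the continuous ones
   are dense in L^2(0, beta) and hence determine the operator. *)
Definition is_free_loop_measure (P : probability (loop beta) R) : Prop :=
  centered_gaussian_loop P /\
  forall f u : R -> R, continuous f -> periodic f -> periodic u ->
    (solves_ode f u <-> {in `[0, beta], u =1 covariance_op P f}).

End LoopMeasures.

Section PotentialSpace.
Context {R : realType}.

Local Notation leb := (@lebesgue_measure R).

Definition Vo (x : R) : R := 2^-1 * x ^+ 2.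

(* The norm of L^2 \cap L^oo, infinite for measurable f outside this space. *)
Definition L2Loo_norm (f : R -> R) : \bar R :=
  ('N[leb]_2%:E [EFin \o f] + 'N[leb]_+oo [EFin \o f])%E.

(* V is represented by V - Vo, a class of a.e. equal measurable functions. *)
Record pot_fun := PotFun {
  pot_ring : {mfun_ leb, measurableTypeR R >-> measurableTypeR R} ;
  pot_finite : (L2Loo_norm pot_ring < +oo)%E }.

Definition pot_val (V : pot_fun) (x : R) : R := Vo x + pot_ring V x.

Let pot0 : {mfun_ leb, measurableTypeR R >-> measurableTypeR R} :=
  \pi_({mfun_ leb, measurableTypeR R >-> measurableTypeR R})%qT
    (cst 0 : {mfun measurableTypeR R >-> measurableTypeR R}).

Let pot0_finite : (L2Loo_norm pot0 < +oo)%E.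
Proof.
have h0 : \forall x \ae leb, repr pot0 x = 0.
  have /eqmodP/asboolP : pot0 = \pi_(_)%qT (repr pot0) by rewrite reprK.
  by apply: filterS => x /(_ I) /esym.
have N2 : ('N[leb]_2%:E [EFin \o pot0] = 0)%E.
  rewrite -(@Lnorm0 _ _ _ leb 2%:E)// unlock; congr (_ `^ _)%E.
  apply: ae_eq_integral => //.
    apply/measurable_EFinP.
    apply: (@measurableT_comp _ _ _ _ _ _ (@powR R ^~ 2)) => //.
    exact: measurableT_comp.
  by apply: filterS h0 => x /= + _; rewrite /aqEqMfun_to_fun => ->.
have Noo : ('N[leb]_+oo [EFin \o pot0] = 0)%E.
  rewrite -(@Lnorm0 _ _ _ leb +oo%E)// unlock; case: ifP => // _.
  apply: eq_ess_sup.
  by apply: filterS h0 => x /=; rewrite /aqEqMfun_to_fun => ->.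
by rewrite /L2Loo_norm N2 Noo adde0.
Qed.

HB.instance Definition _ := gen_eqMixin pot_fun.
HB.instance Definition _ := gen_choiceMixin pot_fun.
HB.instance Definition _ := isPointed.Build pot_fun (PotFun pot0_finite).

Definition pot_open : set (set pot_fun) :=
  [set U | forall V, U V -> exists2 e : R, 0 < e &
    forall W, (L2Loo_norm (pot_val W \- pot_val V)%R < e%:E)%E -> U W].

(* W^1 with the Borel sigma-algebra of its norm. *)
Definition W1 := g_sigma_algebraType pot_open.

End PotentialSpace.
Arguments W1 R : clear implicits.

Section Prior.
Context {R : realType}.

Definition hermite_fun (n : nat) (x : R) : R :=
  (-1) ^+ n * (Num.sqrt (2 ^+ n * n`!%:R * Num.sqrt pi))^-1
  * expR (x ^+ 2 / 2) * (fun z : R => expR (- z ^+ 2))^`(n)%classic x.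

Definition independent_seq d (T : measurableType d) (P : probability T R)
    (xi : nat -> T -> R) : Prop :=
  forall (J : seq nat) (B : nat -> set R), uniq J ->
    (forall i, measurable (B i)) ->
    P (\bigcap_(i in [set` J]) (xi i @^-1` B i))
    = (\prod_(i <- J) P (xi i @^-1` B i))%E.

(* mu0 is the law of a random potential V which is the a.s. limit in W^1 of the
   partial sums of V_o + \sum_i gamma_i xi_i phi_i. *)
Definition is_prior (gamma : nat -> R) (mu0 : probability (W1 R) R) : Prop :=
  exists (d : measure_display) (T : measurableType d) (P : probability T R)
    (xi : nat -> {RV P >-> R}) (V : {RV P >-> W1 R}),
  [/\ independent_seq P xi,
      forall i (B : set R), measurable B ->
        distribution P (xi i) B = normal_prob 0 1 B,
      {ae P, forall w,
        (fun n => L2Loo_norm (fun x => pot_val (V w) x -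
            (Vo x + \sum_(i < n) gamma i * xi i w * hermite_fun i x)))
          @ \oo --> 0%E} &
      forall B : set (W1 R), measurable B -> mu0 B = distribution P V B].

End Prior.

Section Posterior.
Context {R : realType}.
Variables (beta : R) (pi0 : probability (loop beta) R).

Local Notation leb := (@lebesgue_measure R).

(* Independent of the representative of V - Vo: under pi0 each q(t) has a
   Lebesgue density. *)
Definition loop_gibbs (V : W1 R) : probability (loop beta) R :=
  reweight pi0 (fun q : loop beta =>
    \int[leb]_(t in `[0, beta]) pot_ring V (loop_val q t)).

Variables (n : nat) (A : R -> 'cV[R]_n).

Definition loop_average (q : loop beta) : 'cV[R]_n :=
  \col_i (beta^-1 * \int[leb]_(t in `[0, beta]) A (loop_val q t) i ord0).

Definition GA (V : W1 R) : 'cV[R]_n :=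
  \col_i \int[loop_gibbs V]_q loop_average q i ord0.

Variable Gamma : 'M[R]_n.

Definition Phi (V : W1 R) (y : 'cV[R]_n) : R :=
  2^-1 * l2norm (inv_sqrtmx Gamma *m (y - GA V)) ^+ 2
  - 2^-1 * l2norm (inv_sqrtmx Gamma *m y) ^+ 2.

Definition posterior (mu0 : probability (W1 R) R) (y : 'cV[R]_n) :
    probability (W1 R) R :=
  reweight mu0 (fun V => Phi V y).

End Posterior.

(* The value is the same for all nu dominating mu and mu'. *)
Definition hellinger d (T : measurableType d) (R : realType)
    (nu : {sigma_finite_measure set T -> \bar R}) (mu mu' : probability T R)
    : R :=
  Num.sqrt (2^-1 * \int[nu]_x
    (Num.sqrt (fine (Radon_Nikodym (charge_of_finite_measure mu) nu x))
     - Num.sqrt (fine (Radon_Nikodym (charge_of_finite_measure mu') nu x)))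
    ^+ 2).

(* Main.v *)
Require Import Defs.
From HB Require Import structures.
From mathcomp Require Import all_boot all_order all_algebra.
From mathcomp Require Import all_classical all_reals all_analysis.
From mathcomp Require Import measurable_realfun.
From mathcomp Require Import ess_sup_inf ring lra.

Set Implicit Arguments.
Unset Strict Implicit.
Unset Printing Implicit Defensive.

Import Order.TTheory GRing.Theory Num.Theory.
Import numFieldNormedType.Exports.

Local Open Scope classical_set_scope.
Local Open Scope ring_scope.

(** Write S for the matrix Gamma^(-1/2) and G for G^A(V). The terms of
    Phi(V; y) that are quadratic in y cancel, so Phi is affine in y:
    Phi(V; y1) - Phi(V; y2) = - <S (y1 - y2), S G>. The entries of G are
    expectations of averages of a bounded function, hence bounded uniformly
    in V, and |Phi(V; y1) - Phi(V; y2)| <= L |y1 - y2| for all V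
    ([misfit_dist_le]).

    Two functions h1, h2 with |h1 - h2| <= e define, after normalization of
    exp(- h1) dP and exp(- h2) dP, probabilities that dominate each other up
    to the factor exp(2 e) ([reweight_le]), and two such probabilities are at
    Hellinger distance at most e ([hellinger_le]). With e = L |y1 - y2| this
    is the theorem, provided that V |-> Phi(V; y) is measurable, without which
    [posterior] is just the prior.

    That measurability comes from the lower semicontinuity of the entries of
    G^A for the norm of the potential space. If V and W are at distance e, the
    integrals of V and W along a loop differ by at most beta e, so
    [reweight_le] applies to the Gibbs measures and compares G^A(V) with
    G^A(W) ([GA_scale_le]). The distance only controls V - W almost everywhere,
    so one needs that almost every loop spends no time in a given null set
    ([ae_along_free_loop]). By Fubini, this holds because the position of the
    free loop at each time has a density: it is Gaussian, and if it were
    degenerate at time t, then the covariance operator would send every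
    function to one that vanishes at t, whereas it fixes the constant 1
    ([free_loop_eval_neq0]). Fubini requires the joint measurability of
    (q, t) |-> q t, which holds because loops are continuous
    ([measurable_loop_eval2]). *)

(** * Reweighted probability measures *)

Section Normalization.
Context d (T : measurableType d) (R : realType).
Local Open Scope ereal_scope.

(** Passing to the quotient by the masses costs a second factor c. The masses
    are both 0, both infinite, or both positive and finite; in the first two
    cases both normalizations are P. *)
Lemma mnormalize_le (mu nu : {measure set T -> \bar R}) (P : probability T R)
    (c : R) (B : set T) : (1 <= c)%R ->
  mu setT <= c%:E * nu setT -> nu setT <= c%:E * mu setT ->
  mu B <= c%:E * nu B ->
  mnormalize mu P B <= (c ^+ 2)%:E * mnormalize nu P B.
Proof.
move=> c1; rewrite /mnormalize.
have c0 : (0 < c)%R by exact: lt_le_trans c1.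
have PB : P B <= (c ^+ 2)%:E * P B by rewrite lee_pemull// lee_fin exprn_ege1.
have : 0 <= mu setT by [].
have : 0 <= nu setT by [].
have : 0 <= nu B by [].
move: (mu setT) (nu setT) => m n.
case: m => [m||] //; case: n => [n||] //.
rewrite !orbF !lee_fin !eqe /= => nB0 n0 m0 mn nm munuB.
have [m_eq0|m_neq0] := eqVneq m 0%R.
  suff -> : n == 0%R by [].
  by rewrite eq_le n0 andbT (le_trans nm)// m_eq0 mulr0.
have [n_eq0|n_neq0] := eqVneq n 0%R.
  case/eqP: m_neq0; apply/eqP; rewrite eq_le m0 andbT (le_trans mn)//.
  by rewrite n_eq0 mulr0.
have mp : (0 < m)%R by rewrite lt0r m_neq0.
have np : (0 < n)%R by rewrite lt0r n_neq0.
rewrite expr2 (EFinM c c) -muleA.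
apply: (@le_trans _ _ (c%:E * nu B * m^-1%:E)).
  by rewrite lee_wpmul2r// lee_fin invr_ge0.
rewrite -muleA lee_wpmul2l ?lee_fin ?(ltW c0)//.
rewrite [leRHS]muleCA lee_wpmul2l// -EFinM lee_fin.
by rewrite ler_pdivlMr// mulrC ler_pdivrMr.
Qed.

End Normalization.

Section Reweighting.
Context d (T : measurableType d) (R : realType) (P : probability T R).
Local Open Scope ereal_scope.
Implicit Types (h : T -> R) (e : R) (B : set T).

Let measurable_expRN h : measurable_fun [set: T] h ->
  measurable_fun [set: T] (fun x => (expR (- h x))%:E).
Proof.
by move=> mh; apply/measurable_EFinP; apply: measurableT_comp => //;
  exact: measurableT_comp.
Qed.

Lemma exp_density_le h1 h2 e B :
  measurable_fun [set: T] h1 -> measurable_fun [set: T] h2 ->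
  {ae P, forall x, (`|h1 x - h2 x| <= e)%R} -> measurable B ->
  exp_density P h1 B <= (expR e)%:E * exp_density P h2 B.
Proof.
move=> mh1 mh2 h12 mB; rewrite /exp_density !asboolT//.
rewrite -ge0_integralZl//; last first.
  exact/measurable_funTS/measurable_expRN.
apply: ae_ge0_le_integral => //.
- exact/measurable_funTS/measurable_expRN.
- apply: measurable_funeM; exact/measurable_funTS/measurable_expRN.
apply: filterS h12 => x hx _.
rewrite -EFinM lee_fin -expRD ler_expR.
by move: hx; rewrite ler_distlC => /andP[]; lra.
Qed.

(** One factor exp e comes from the densities and one from the normalizing
    constants. *)
Lemma reweight_le h1 h2 e B : (0 <= e)%R ->
  measurable_fun [set: T] h1 -> measurable_fun [set: T] h2 ->
  {ae P, forall x, (`|h1 x - h2 x| <= e)%R} -> measurable B ->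
  reweight P h1 B <= (expR (2 * e))%:E * reweight P h2 B.
Proof.
move=> e0 mh1 mh2 h12 mB.
have h21 : {ae P, forall x, (`|h2 x - h1 x| <= e)%R}.
  by apply: filterS h12 => x; rewrite distrC.
rewrite mulr_natl mulr2n expRD -expr2.
apply: (@mnormalize_le _ _ _ (exp_density P h1) (exp_density P h2)).
- by rewrite -[leLHS]expR0 ler_expR.
- exact: exp_density_le.
- exact: exp_density_le.
- exact: exp_density_le.
Qed.

End Reweighting.

(** * Hellinger distance of mutually dominating probabilities *)

Section SqrtDensity.
Context (R : realType).

(** For a <= b, the hypotheses give sqrt a >= exp(- e) sqrt b >=
    (1 - e) sqrt b. *)
Lemma sqr_sqrtB_le (a b e : R) : 0 <= a -> 0 <= b ->
  a <= expR (2 * e) * b -> b <= expR (2 * e) * a ->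
  (Num.sqrt a - Num.sqrt b) ^+ 2 <= e ^+ 2 * (a + b).
Proof.
wlog ab : a b / a <= b => [hw|] a0 b0 aleb blea.
  have [/hw|/ltW /hw h] := leP a b; first exact.
  by rewrite [a + b]addrC -sqrrN opprB h.
have sab : Num.sqrt a <= Num.sqrt b by rewrite ler_sqrt.
have sba : Num.sqrt b <= expR e * Num.sqrt a.
  rewrite -(ler_pXn2r (n := 2)) ?nnegrE ?mulr_ge0 ?expR_ge0 ?sqrtr_ge0//.
  by rewrite exprMn !sqr_sqrtr// -expRM_natl.
have sbe : Num.sqrt b - Num.sqrt a <= e * Num.sqrt b.
  have : (1 - e) * Num.sqrt b <= Num.sqrt a.
    apply: (@le_trans _ _ (expR (- e) * Num.sqrt b)).
      by rewrite ler_wpM2r ?sqrtr_ge0// expR_ge1Dx.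
    by rewrite expRN ler_pdivrMl ?expR_gt0.
  lra.
rewrite -sqrrN opprB; apply: (@le_trans _ _ ((e * Num.sqrt b) ^+ 2)).
  rewrite ler_pXn2r ?nnegrE ?subr_ge0//.
  by apply: le_trans sbe; rewrite subr_ge0.
by rewrite exprMn sqr_sqrtr// ler_wpM2l ?sqr_ge0// lerDr.
Qed.

End SqrtDensity.

Section Hellinger.
Context d (T : measurableType d) (R : realType).
Local Open Scope ereal_scope.

(** On the set where g is negative, all integrals of g vanish. *)
Lemma integral_ge0_ae (mu : {measure set T -> \bar R}) (g : T -> \bar R) :
  mu.-integrable setT g ->
  (forall E, measurable E -> 0 <= \int[mu]_(x in E) g x) ->
  {ae mu, forall x, 0 <= g x}.
Proof.
move=> ig g0; have mg := measurable_int _ ig.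
have mD : measurable [set x | g x < 0].
  by rewrite -[X in measurable X]setTI; exact: emeasurable_fun_infty_o.
have : ae_eq mu [set x | g x < 0] g (cst 0).
  apply: integral_ae_eq => //; first exact: integrableS ig.
  move=> E ED mE; apply/eqP; rewrite eq_le; apply/andP; split; last first.
    by rewrite integral0; exact: g0.
  apply: le_integral => //; first exact: integrableS ig.
    exact: integrable0.
  by move=> x; rewrite inE => /ED /= /ltW.
by apply: filterS => x gx; rewrite leNgt; apply/negP => gx0;
  move: (gx0); rewrite gx// ltxx.
Qed.

Variables (nu : {sigma_finite_measure set T -> \bar R}).

(** The densities f1, f2 inherit the domination almost everywhere, hence
    (sqrt f1 - sqrt f2)^2 <= e^2 (f1 + f2), and f1 + f2 has integral 2. *)
Lemma hellinger_le (mu1 mu2 : probability T R) (e : R) : (0 <= e)%R ->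
  mu1 `<< nu -> mu2 `<< nu ->
  (forall B, measurable B -> mu1 B <= (expR (2 * e))%:E * mu2 B) ->
  (forall B, measurable B -> mu2 B <= (expR (2 * e))%:E * mu1 B) ->
  (hellinger nu mu1 mu2 <= e)%R.
Proof.
move=> e0 mu1nu mu2nu mu12 mu21.
have RNge0 (mu : probability T R) : mu `<< nu ->
    {ae nu, forall x, 0 <= Radon_Nikodym (charge_of_finite_measure mu) nu x}.
  move=> munu; apply: integral_ge0_ae; first exact: Radon_Nikodym_integrable.
  by move=> E mE; rewrite -Radon_Nikodym_integral.
have RNle (mu mu' : probability T R) : mu `<< nu -> mu' `<< nu ->
    (forall B, measurable B -> mu B <= (expR (2 * e))%:E * mu' B) ->
    {ae nu, forall x, Radon_Nikodym (charge_of_finite_measure mu) nu x <=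
      (expR (2 * e))%:E * Radon_Nikodym (charge_of_finite_measure mu') nu x}.
  move=> munu mu'nu mumu'.
  pose f := Radon_Nikodym (charge_of_finite_measure mu) nu.
  pose f' := Radon_Nikodym (charge_of_finite_measure mu') nu.
  have ff' : {ae nu, forall x, 0 <= (expR (2 * e))%:E * f' x - f x}.
    have if' : nu.-integrable setT f' by exact: Radon_Nikodym_integrable.
    have if_ : nu.-integrable setT f by exact: Radon_Nikodym_integrable.
    apply: integral_ge0_ae.
      by apply: integrableB => //; exact: integrableZl.
    move=> E mE.
    have if'E := integrableS measurableT mE (@subsetT _ E) if'.
    have if_E := integrableS measurableT mE (@subsetT _ E) if_.
    rewrite integralB//; last exact: integrableZl.
    rewrite integralZl// -!Radon_Nikodym_integral//.
    by rewrite sube_ge0 ?mumu'// ?fin_num_measure.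
  apply: filterS ff' => x.
  by rewrite sube_ge0// ?Radon_Nikodym_fin_num.
pose f1 := Radon_Nikodym (charge_of_finite_measure mu1) nu.
pose f2 := Radon_Nikodym (charge_of_finite_measure mu2) nu.
have if1 : nu.-integrable setT f1 by exact: Radon_Nikodym_integrable.
have if2 : nu.-integrable setT f2 by exact: Radon_Nikodym_integrable.
have ff1 x : f1 x \is a fin_num by exact: Radon_Nikodym_fin_num.
have ff2 x : f2 x \is a fin_num by exact: Radon_Nikodym_fin_num.
have mf1 : measurable_fun setT f1 := measurable_int _ if1.
have mf2 : measurable_fun setT f2 := measurable_int _ if2.
have mn1 : measurable_fun setT (fun x => `|f1 x|) by exact: measurableT_comp.
have mn2 : measurable_fun setT (fun x => `|f2 x|) by exact: measurableT_comp.
have msqrt (f : T -> \bar R) : measurable_fun setT f ->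
    measurable_fun setT (fun x => Num.sqrt (fine (f x))).
  move=> mf; apply: measurableT_comp.
    by apply: continuous_measurable_fun; exact: sqrt_continuous.
  by apply: measurableT_comp mf; exact: fine_measurable.
have norm1 (mu : probability T R) : mu `<< nu ->
    \int[nu]_x `|Radon_Nikodym (charge_of_finite_measure mu) nu x| = 1.
  move=> munu; rewrite -[RHS](probability_setT mu).
  rewrite -[RHS]/(charge_of_finite_measure mu setT).
  rewrite (@Radon_Nikodym_integral _ _ _ _ nu)//.
  have mf : measurable_fun setT
      (Radon_Nikodym (charge_of_finite_measure mu) nu).
    by apply: measurable_int; exact: Radon_Nikodym_integrable.
  apply: ae_eq_integral => //; first exact: measurableT_comp.
  by apply: filterS (RNge0 _ munu) => x fx _; rewrite gee0_abs.
rewrite /hellinger -/f1 -/f2.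
have I_le : \int[nu]_x
    ((Num.sqrt (fine (f1 x)) - Num.sqrt (fine (f2 x))) ^+ 2)%:E <=
    (2 * e ^+ 2)%:E.
  apply: (@le_trans _ _ (\int[nu]_x ((e ^+ 2)%:E * (`|f1 x| + `|f2 x|)))).
    apply: ae_ge0_le_integral => //.
    - by move=> x _; rewrite lee_fin sqr_ge0.
    - apply/measurable_EFinP; apply: measurable_funX.
      by apply: measurable_funB; exact: msqrt.
    - by move=> x _; rewrite mule_ge0// ?lee_fin ?sqr_ge0// adde_ge0.
    - exact/measurable_funeM/emeasurable_funD.
    have RN0 : {ae nu, forall x, 0 <= f1 x /\ 0 <= f2 x}.
      by apply: filterI; exact: RNge0.
    have RNc : {ae nu, forall x, f1 x <= (expR (2 * e))%:E * f2 x /\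
        f2 x <= (expR (2 * e))%:E * f1 x}.
      by apply: filterI; exact: RNle.
    move: RN0 RNc; apply: filterS2 => x.
    rewrite -(fineK (ff1 x)) -(fineK (ff2 x)).
    rewrite -!EFinM !lee_fin => -[f10 f20] [f12 f21] _.
    by rewrite !ger0_norm// sqr_sqrtB_le.
  rewrite ge0_integralZl//.
  - rewrite ge0_integralD//.
    by rewrite !norm1// -EFinM lee_fin mulrC.
  - exact: emeasurable_funD.
  - by move=> x _; rewrite adde_ge0.
  - by rewrite lee_fin sqr_ge0.
rewrite -[leRHS](ger0_norm e0) -sqrtr_sqr ler_sqrt ?sqr_ge0//.
rewrite ler_pdivrMl// -lee_fin (le_trans _ I_le)//.
have I_fin : \int[nu]_x
    ((Num.sqrt (fine (f1 x)) - Num.sqrt (fine (f2 x))) ^+ 2)%:E \is a fin_num.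
  rewrite ge0_fin_numE; first by apply: le_lt_trans I_le _; rewrite ltry.
  by apply: integral_ge0 => x _; rewrite lee_fin sqr_ge0.
by rewrite (fineK I_fin).
Qed.

End Hellinger.

(** * Loops as jointly measurable functions of the loop and the time *)

Section LoopEvaluation.
Context {R : realType} (beta : R).
Hypothesis beta_gt0 : 0 < beta.
Local Notation leb := (@lebesgue_measure R).

Lemma measurable_loop_eval (t : R) :
  measurable_fun [set: loop beta] (fun q : loop beta => loop_val q t).
Proof.
have [t0b|t0b] := boolP (t \in `[0, beta]).
  move=> _ B mB; apply: sub_gen_smallest; exists t => //.
  by exists B.
rewrite (_ : (fun _ => _) = cst 0); first exact: measurable_cst.
by apply/funext => q; exact: loop_outside.
Qed.

Lemma loop_eval_cvg (q : loop beta) (t : R) (u : nat -> R) :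
  t \in `[0, beta] -> (forall n, u n \in `[0, beta]) ->
  u @ \oo --> t -> (fun n => loop_val q (u n)) @ \oo --> loop_val q t.
Proof.
move=> t0b u0b ut.
have /subspace_continuousP /(_ t t0b) qt := @loop_continuous _ _ q.
apply: (cvg_comp _ (loop_val q)) qt => B nB.
have : \forall n \near \oo, `[0, beta]%classic (u n) -> B (u n) := ut _ nB.
by apply: filterS => n; apply; exact: u0b.
Qed.

(** The value at the last multiple of beta / n.+1 before p.2. The factor in
    front discards the times outside [0, beta], where loops vanish; the index
    n.+1 of the sum is reached at time beta only. *)
Let grid_eval n (p : loop beta * R) : R :=
  \1_(`[0, beta]) p.2 *
  \sum_(k < n.+2)
    \1_(`[k%:R * (beta / n.+1%:R), k.+1%:R * (beta / n.+1%:R)[) p.2 *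
    loop_val p.1 (k%:R * (beta / n.+1%:R)).

Let measurable_grid_eval n : measurable_fun setT (grid_eval n).
Proof.
have m1 (i : interval R) : measurable_fun [set: loop beta * R]
    (fun p => \1_[set` i] p.2 : R).
  apply: (measurableT_comp _ measurable_snd).
  apply: measurable_indic; exact: measurable_itv.
apply: measurable_funM; first exact: m1.
apply: measurable_sum => k; apply: measurable_funM; first exact: m1.
exact: (measurableT_comp (measurable_loop_eval _) measurable_fst).
Qed.

Let grid_eval_cvg p : grid_eval ^~ p @ \oo --> loop_val p.1 p.2.
Proof.
case: p => q t; rewrite /grid_eval /=.
have [t0b|t0b] := boolP (t \in `[0, beta]); last first.
  rewrite (_ : (fun _ => _) = cst (loop_val q t)); first exact: cvg_cst.
  apply/funext => n; rewrite indicE memNset ?mul0r.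
    by rewrite loop_outside.
  exact/negP.
pose k n := Num.truncn (t / (beta / n.+1%:R)).
have d0 n : 0 < beta / n.+1%:R :> R by rewrite divr_gt0.
have t0 : 0 <= t by move: t0b; rewrite in_itv => /andP[].
have tb : t <= beta by move: t0b; rewrite in_itv => /andP[].
have kt n : (k n)%:R * (beta / n.+1%:R) <= t < (k n).+1%:R * (beta / n.+1%:R).
  rewrite -ler_pdivlMr// -ltr_pdivrMr//.
  by apply: truncn_itv; rewrite divr_ge0// ltW.
have kn n : (k n < n.+2)%N.
  rewrite -(ltr_nat R); case/andP: (kt n) => kt' _.
  rewrite -(ltr_pM2r (d0 n)); apply: (le_lt_trans kt').
  apply: (le_lt_trans tb).
  by rewrite mulrCA ltr_pMr// ltr_pdivlMr// mul1r ltr_nat.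
pose u n := (k n)%:R * (beta / n.+1%:R).
rewrite (_ : (fun _ => _) = (fun n => loop_val q (u n))); last first.
  apply/funext => n; rewrite indicE mem_set// mul1r.
  rewrite (bigD1 (Ordinal (kn n)))//= indicE mem_set/=; last first.
    by rewrite in_itv/= kt.
  rewrite mul1r big1 ?addr0// => i ik.
  rewrite indicE memNset ?mul0r//= in_itv/= => /andP[it ti].
  case/andP: (kt n) => kt1 kt2.
  move/negP: ik; apply; rewrite -val_eqE /= eqn_leq.
  have := le_lt_trans it kt2; rewrite ltr_pM2r// ltr_nat ltnS => ->.
  by have := le_lt_trans kt1 ti; rewrite ltr_pM2r// ltr_nat ltnS => ->.
apply: loop_eval_cvg => //.
  move=> n; rewrite in_itv/= mulr_ge0 ?(ltW (d0 n))//=.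
  by case/andP: (kt n) => + _ => /le_trans; apply.
apply/cvgrPdist_le => e e0; near=> n.
rewrite ger0_norm ?subr_ge0; last by case/andP: (kt n).
case/andP: (kt n) => _; rewrite -addn1 natrD mulrDl mul1r => tu.
apply: (@le_trans _ _ (beta / n.+1%:R)); first by rewrite lerBlDl ltW.
rewrite ler_pdivrMr// -ler_pdivrMl//.
near: n; exists (Num.truncn (e^-1 * beta)).+1 => // m /= em.
apply: ltW; apply: (lt_trans (truncnS_gt _)).
by rewrite ltr_nat ltnS.
Unshelve. all: by end_near. Qed.

(** The sigma-algebra only knows the evaluations at fixed times; continuity of
    the loops makes (q, t) |-> q t a pointwise limit of functions that depend
    on t through finitely many such evaluations. *)
Lemma measurable_loop_eval2 :
  measurable_fun setT (fun p : loop beta * R => loop_val p.1 p.2).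
Proof.
by apply: (@measurable_fun_cvg _ _ _ _ grid_eval) => // p _;
  exact: grid_eval_cvg.
Qed.

(** Valid for every measurable g, also when the integral diverges: the
    integrals of the positive and negative parts are measurable by Tonelli,
    and [Rintegral] is a measurable function of the two. *)
Lemma measurable_loop_integral (g : R -> R) : measurable_fun setT g ->
  measurable_fun [set: loop beta]
    (fun q : loop beta => \int[leb]_(t in `[0, beta]) g (loop_val q t)).
Proof.
move=> mg.
pose F (p : loop beta * R) : \bar R :=
  (\1_(`[0, beta]) p.2 * g (loop_val p.1 p.2))%:E.
have mF : measurable_fun setT F.
  apply/measurable_EFinP; apply: measurable_funM.
    apply: (measurableT_comp _ measurable_snd).
    apply: measurable_indic; exact: measurable_itv.
  exact: (measurableT_comp mg measurable_loop_eval2).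
have -> : (fun q : loop beta => \int[leb]_(t in `[0, beta]) g (loop_val q t)) =
    fine \o (fun q => \int[leb]_t (F^\+ (q, t)) - \int[leb]_t (F^\- (q, t)))%E.
  apply/funext => q /=; rewrite /Rintegral integral_mkcond integralE.
  by congr (fine (_ - _)%E); apply: eq_integral => t _;
    rewrite ?(funeposE, funenegE) patchE /F indicE; case: ifP;
    rewrite /= ?mul1r ?mul0r.
apply: measurableT_comp; first exact: fine_measurable.
apply: emeasurable_funB.
- apply: (@measurable_fun_fubini_tonelli_F _ _ _ _ _ leb F^\+%E) => //.
  exact: measurable_funepos.
- apply: (@measurable_fun_fubini_tonelli_F _ _ _ _ _ leb F^\-%E) => //.
  exact: measurable_funeneg.
Qed.

End LoopEvaluation.

(** * One-time laws of the free loop measure *)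

Section FreeLoopMarginals.
Context {R : realType} (beta M : R) (P : probability (loop beta) R).
Hypothesis beta_gt0 : 0 < beta.
Hypothesis PM : is_free_loop_measure M P.
Local Notation leb := (@lebesgue_measure R).

Let solves_ode_cst1 : solves_ode M (cst 1) (cst 1).
Proof.
have d1 : (cst 1 : R -> R)^`()%classic = cst 0.
  by apply/funext => x; rewrite derive1_cst.
move=> t; split; first exact: derivable_cst.
- by rewrite d1; exact: derivable_cst.
- by rewrite derive1nS derive1n1 d1 derive1_cst mulr0 add0r.
Qed.

Let covariance_op_cst1 t : t \in `[0, beta] -> covariance_op P (cst 1) t = 1.
Proof.
move=> t0b; have [_ /(_ (cst 1) (cst 1))] := PM.
case=> [||//|/(_ solves_ode_cst1) + _]; first exact: cst_continuous.
  by [].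
by move=> /(_ t t0b) /= <-.
Qed.

(** If q t were almost surely 0, it would be uncorrelated with every q s, and
    the covariance operator would map 1 to a function vanishing at t. But
    u = 1 is a periodic solution of - M u'' + u = 1. *)
Lemma free_loop_eval_neq0 t : t \in `[0, beta] ->
  ~ {ae P, forall q : loop beta, loop_val q t = 0}.
Proof.
move=> t0b q0; have := covariance_op_cst1 t0b.
rewrite /covariance_op (_ : (fun _ => _) = cst 0).
  by rewrite Rintegral_cst// mul0r => /eqP; rewrite eq_sym oner_eq0.
have Et0 : ('E_P[fun q : loop beta => loop_val q t] = 0)%E.
  rewrite unlock -[RHS](integral0 P setT); apply: ae_eq_integral => //.
    by apply/measurable_EFinP; exact: measurable_loop_eval.
  by apply: filterS q0 => q /= -> _.
apply/funext => s; rewrite mulr1.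
rewrite (_ : covariance _ _ _ = 0%E)// unlock Et0 /=.
rewrite unlock -[RHS](integral0 P setT); apply: ae_eq_integral => //.
  apply/measurable_EFinP; apply: measurable_funM; apply: measurable_funB => //;
    exact: measurable_loop_eval.
by apply: filterS q0 => q qt0 _; rewrite /= !fctE /= qt0 subr0 mul0r.
Qed.

(** The Dirac alternative in [centered_gaussian_law] contradicts
    [free_loop_eval_neq0]. *)
Lemma free_loop_marginal t : t \in `[0, beta] ->
  exists sigma : R, forall B : set R, measurable B ->
    P [set q : loop beta | B (loop_val q t)] = normal_prob 0 sigma B.
Proof.
move=> t0b.
have [/(_ 1%N (fun=> 1) (fun=> t) (fun=> t0b))[sigma sigmaP] _] := PM.
exists sigma => B mB.
have := sigmaP _ mB; rewrite /centered_gaussian_law.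
have -> : [set q : loop beta | B (\sum_(i < 1) 1 * loop_val q t)] =
    [set q : loop beta | B (loop_val q t)].
  by apply/funext => q; rewrite /= big_ord1 mul1r.
case: eqVneq => // sigma0.
exfalso; apply: (free_loop_eval_neq0 t0b).
have := sigmaP [set~ 0] _; rewrite /centered_gaussian_law sigma0 eqxx.
rewrite diracE memNset; last by move=> /(_ erefl).
move=> /(_ (measurableC (measurable_set1 _))) h.
exists [set q : loop beta | [set~ 0] (\sum_(i < 1) 1 * loop_val q t)]; split.
- under eq_set do rewrite big_ord1 mul1r.
  rewrite -[X in measurable X]setTI.
  by apply: measurable_loop_eval => //; exact: measurableC.
- exact: h.
- by move=> q /= qt; rewrite big_ord1 mul1r.
Qed.

(** For each t, the law of q t is absolutely continuous, so the expected time
    that q spends in the exceptional null set is 0 by Tonelli. *)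
Lemma ae_along_free_loop (Q : R -> Prop) : {ae leb, forall x, Q x} ->
  {ae P, forall q : loop beta,
    {ae leb, forall t, t \in `[0, beta] -> Q (loop_val q t)}}.
Proof.
move=> [N [mN N0 QN]].
pose G (p : loop beta * R) : \bar R :=
  (\1_(`[0, beta]) p.2 * \1_N (loop_val p.1 p.2))%:E.
have G0 p : (0 <= G p)%E by rewrite lee_fin mulr_ge0.
have mG : measurable_fun setT G.
  apply/measurable_EFinP; apply: measurable_funM.
    apply: (measurableT_comp _ measurable_snd).
    by apply: measurable_indic; exact: measurable_itv.
  apply: measurableT_comp (measurable_loop_eval2 beta_gt0).
  exact: measurable_indic.
have mGt q : measurable_fun setT (fun t => G (q, t)).
  by apply: measurableT_comp mG _; exact: pair1_measurable.
have GE : (\int[P]_q \int[leb]_t G (q, t) = 0)%E.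
  rewrite (@fubini_tonelli _ _ _ _ _ P leb G)//.
  rewrite -[RHS](integral0 leb setT); apply: eq_integral => t _.
  have [t0b|t0b] := boolP (t \in `[0, beta]); last first.
    rewrite -[RHS](integral0 P setT); apply: eq_integral => q _.
    by rewrite /G /= indicE memNset ?mul0r//; exact/negP.
  transitivity (\int[P]_q (\1_[set q : loop beta | N (loop_val q t)] q)%:E)%E.
    by apply: eq_integral => q _; rewrite /G /= [\1__ t]indicE mem_set ?mul1r.
  rewrite integral_indic//; last first.
    by rewrite -[X in measurable X]setTI; exact: measurable_loop_eval.
  rewrite setIT; have [sigma PN] := free_loop_marginal t0b.
  rewrite [LHS](PN _ mN).
  by have /null_content_dominatesP := normal_prob_dominates 0 sigma; apply.
have mI : measurable_fun setT (fun q => \int[leb]_t G (q, t))%E.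
  exact: (@measurable_fun_fubini_tonelli_F _ _ _ _ _ leb G).
have : ae_eq P setT (fun q => \int[leb]_t G (q, t))%E (cst 0%E).
  apply/ae_eq_integral_abs => //; rewrite -[RHS]GE.
  by apply: eq_integral => q _; rewrite gee0_abs// integral_ge0.
apply: filterS => q /(_ I) /= Gq0.
have : ae_eq leb setT (fun t => G (q, t)) (cst 0%E).
  apply/ae_eq_integral_abs => //; first exact: mGt.
  by rewrite -[RHS]Gq0; apply: eq_integral => t _; rewrite gee0_abs.
apply: filterS => t /(_ I) /= Gqt t0b; apply: contrapT => nQ.
move: Gqt; rewrite /G /= !indicE !mem_set ?mulr1//; last exact: QN.
by move=> /eqP; rewrite eqe oner_eq0.
Qed.

End FreeLoopMarginals.

(** * Integrals of bounded functions *)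

Section BoundedIntegrals.
Context d (T : measurableType d) (R : realType).
Variables (mu : {measure set T -> \bar R}) (D : set T).
Hypotheses (mD : measurable D) (muD : (mu D < +oo)%E).
Implicit Types (f : T -> R) (K : R).

Let le_integral_cst f K : 0 <= K -> measurable_fun D f ->
  {ae mu, forall x, D x -> `|f x| <= K} ->
  (\int[mu]_(x in D) `|(f x)%:E| <= K%:E * mu D)%E.
Proof.
move=> K0 mf fK; rewrite -integral_cst//; apply: ae_ge0_le_integral => //.
by apply: measurableT_comp => //; exact/measurable_EFinP.
Qed.

Lemma ae_bounded_integrable f K : 0 <= K -> measurable_fun D f ->
  {ae mu, forall x, D x -> `|f x| <= K} -> mu.-integrable D (EFin \o f).
Proof.
move=> K0 mf fK; apply/integrableP; split; first exact/measurable_EFinP.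
apply: le_lt_trans (le_integral_cst K0 mf fK) _.
by rewrite lte_mul_pinfty.
Qed.

Lemma normr_Rintegral_le f K : 0 <= K -> measurable_fun D f ->
  {ae mu, forall x, D x -> `|f x| <= K} ->
  `|\int[mu]_(x in D) f x| <= K * fine (mu D).
Proof.
move=> K0 mf fK.
have fi := ae_bounded_integrable K0 mf fK.
rewrite -lee_fin EFin_normr_Rintegral// EFinM fineK ?ge0_fin_numE//.
apply: le_trans (le_integral_cst K0 mf fK).
by apply: le_abse_integral => //; exact/measurable_EFinP.
Qed.

End BoundedIntegrals.

Section ProbabilityComparison.
Context d (T : measurableType d) (R : realType).

(** Domination of measures only compares integrals of nonnegative functions,
    whence the shift by the bound K. *)
Lemma Rintegral_scale_le (P Q : probability T R) (X : T -> R) (K c : R) :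
  0 <= K -> 0 <= c -> measurable_fun setT X -> (forall x, `|X x| <= K) ->
  (forall B, measurable B -> (P B <= c%:E * Q B)%E) ->
  (\int[P]_x X x) + K <= c * ((\int[Q]_x X x) + K).
Proof.
move=> K0 c0 mX XK PQ.
have XK0 x : 0 <= X x + K.
  by rewrite -lerBlDr sub0r; case/ler_normlP: (XK x); lra.
have mXK : measurable_fun setT (fun x => X x + K) by exact: measurable_funD.
have shift (S : probability T R) :
    (\int[S]_x (X x + K)%:E)%E = ((\int[S]_x X x) + K)%:E.
  have ST : (S setT < +oo)%E by rewrite probability_setT ltry.
  have iX : S.-integrable setT (EFin \o X).
    apply: (ae_bounded_integrable measurableT ST K0) => //.
    by apply: aeW => x _; exact: XK.
  rewrite EFinD /Rintegral fineK; last exact: integrable_fin_num.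
  under [LHS]eq_integral do rewrite EFinD.
  rewrite integralD//.
    congr (_ + _)%E; rewrite integral_cst// -[RHS]mule1; congr (_ * _)%E.
    exact: probability_setT.
  apply: (ae_bounded_integrable measurableT ST K0 (f := cst K)) => //.
  by apply: aeW => x _; rewrite ger0_norm.
rewrite -lee_fin EFinM -!shift.
pose c' := NngNum c0.
have -> : (c%:E = c'%:num%:E)%E by [].
rewrite -ge0_integral_mscale//; first last.
- by move=> x _; rewrite lee_fin.
- exact/measurable_EFinP.
apply: ge0_le_measure_integral => //.
exact/measurable_EFinP.
Qed.

End ProbabilityComparison.

(** * Almost everywhere bounds from the norm of potentials *)

(** Stated for the bare set function [lebesgue_measure], from which type class
    inference cannot recover the measure that carries it. *)
#[local] Instance ae_lebesgue_filter (R : realType) :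
  Filter (nbhs (almost_everywhere (@lebesgue_measure R))).
Proof. exact: (@ae_filter_ringOfSetsType _ _ _ (@lebesgue_measure R)). Qed.

Section PotentialNorm.
Context {R : realType}.
Local Notation leb := (@lebesgue_measure R).

Lemma L2Loo_norm_ae (f : R -> R) (e : R) : (L2Loo_norm f <= e%:E)%E ->
  {ae leb, forall x, `|f x| <= e}.
Proof.
move=> fe; have : ('N[leb]_+oo [EFin \o f] <= e%:E)%E.
  by apply: le_trans fe; rewrite /L2Loo_norm leeDr// Lnorm_ge0.
have leT : (0 < leb setT)%E.
  by rewrite -set_itvNyy lebesgue_measure_itv/=; exact: lt0y.
rewrite unlock ifT; last exact: leT.
by move=> /ess_supP; apply: filterS => x; rewrite /= lee_fin.
Qed.

Lemma pot_ring_ae_bounded (V : W1 R) :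
  exists2 K : R, 0 <= K & {ae leb, forall x, `|pot_ring V x| <= K}.
Proof.
have V0 : (0 <= L2Loo_norm (pot_ring V))%E by rewrite adde_ge0 ?Lnorm_ge0.
exists (fine (L2Loo_norm (pot_ring V))); first exact: fine_ge0.
by apply: L2Loo_norm_ae; rewrite fineK// ge0_fin_numE// pot_finite.
Qed.

End PotentialNorm.

(** * Dependence of the Gibbs averages on the potential *)

Section Observables.
Context {R : realType} (beta M : R) (pi0 : probability (loop beta) R).
Hypothesis beta_gt0 : 0 < beta.
Hypothesis pi0P : is_free_loop_measure M pi0.
Variables (n : nat) (A : R -> 'cV[R]_n).
Hypothesis A_meas : forall i, measurable_fun setT (fun x => A x i ord0).
Variable K : R.
Hypothesis A_le : forall x i, `|A x i ord0| <= K.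
Local Notation leb := (@lebesgue_measure R).
Implicit Types V W : W1 R.

Let potential_int V (q : loop beta) :=
  \int[leb]_(t in `[0, beta]) pot_ring V (loop_val q t).

Let leb_itv : (leb `[0%R, beta] = beta%:E)%E.
Proof. by rewrite lebesgue_measure_itv/= lte_fin beta_gt0 oppr0 addr0. Qed.

Let leb_itv_fine : fine (leb `[0%R, beta]) = beta.
Proof. by rewrite leb_itv. Qed.

Let leb_itv_lty : (leb `[0%R, beta] < +oo)%E.
Proof. by rewrite leb_itv ltry. Qed.

Let measurable_along (g : R -> R) (q : loop beta) : measurable_fun setT g ->
  measurable_fun `[0, beta] (fun t => g (loop_val q t)).
Proof.
move=> mg; apply: measurable_funTS; apply: measurableT_comp mg _.
pose ev (p : loop beta * R) := loop_val p.1 p.2.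
have mev : measurable_fun setT ev := measurable_loop_eval2 beta_gt0.
apply: (measurableT_comp mev (g := fun t => (q, t))); exact: pair1_measurable.
Qed.

Let measurable_pot_ring V : measurable_fun setT (pot_ring V).
Proof. by []. Qed.

Let measurable_potential_int V : measurable_fun setT (potential_int V).
Proof. exact: (measurable_loop_integral beta_gt0 (measurable_pot_ring V)). Qed.

(** The norm bounds V, W and W - V only outside a Lebesgue-null set, which
    almost every loop avoids at almost every time. *)
Lemma potential_int_dist V W e : 0 <= e ->
  (L2Loo_norm (pot_val W \- pot_val V)%R <= e%:E)%E ->
  {ae pi0, forall q, `|potential_int W q - potential_int V q| <= e * beta}.
Proof.
move=> e0 /L2Loo_norm_ae WV.
have {}WV : {ae leb, forall x, `|pot_ring W x - pot_ring V x| <= e}.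
  apply: filterS WV => x.
  by rewrite /pot_val /= opprD addrACA subrr add0r.
have [KV KV0 VK] := pot_ring_ae_bounded V.
have [KW KW0 WK] := pot_ring_ae_bounded W.
have ae := ae_along_free_loop beta_gt0 pi0P.
have aeVW : {ae pi0, forall q : loop beta,
    [/\ {ae leb, forall t, t \in `[0, beta] ->
          `|pot_ring V (loop_val q t)| <= KV},
        {ae leb, forall t, t \in `[0, beta] ->
          `|pot_ring W (loop_val q t)| <= KW} &
        {ae leb, forall t, t \in `[0, beta] ->
          `|pot_ring W (loop_val q t) - pot_ring V (loop_val q t)| <= e}]}.
  have WVq := ae (fun x => `|pot_ring W x - pot_ring V x| <= e) WV.
  move: (ae _ VK) (ae _ WK) WVq; apply: filterS3 => q; exact: And3.
apply: filterS aeVW => q [Vq Wq WVq].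
have mV := measurable_along q (measurable_pot_ring V).
have mW := measurable_along q (measurable_pot_ring W).
have iV : leb.-integrable `[0, beta]
    (EFin \o (fun t => pot_ring V (loop_val q t))).
  exact: (ae_bounded_integrable _ leb_itv_lty KV0 mV Vq).
have iW : leb.-integrable `[0, beta]
    (EFin \o (fun t => pot_ring W (loop_val q t))).
  exact: (ae_bounded_integrable _ leb_itv_lty KW0 mW Wq).
rewrite /potential_int -RintegralB//.
rewrite -[X in e * X]leb_itv_fine.
exact: (normr_Rintegral_le _ leb_itv_lty e0 (measurable_funB mW mV) WVq).
Qed.

Let loop_average_le i (q : loop beta) : `|loop_average A q i ord0| <= K.
Proof.
have K0 : 0 <= K by exact: le_trans (A_le 0 i).
rewrite mxE normrM ger0_norm ?invr_ge0 ?(ltW beta_gt0)// ler_pdivrMl// mulrC.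
rewrite -[X in K * X]leb_itv_fine.
apply: (normr_Rintegral_le _ leb_itv_lty K0
  (measurable_along q (A_meas i))) => //.
by apply: aeW => t _; exact: A_le.
Qed.

Let measurable_loop_average i :
  measurable_fun setT (fun q : loop beta => loop_average A q i ord0).
Proof.
under eq_fun do rewrite mxE.
apply: measurable_funM => //.
exact: (measurable_loop_integral beta_gt0 (A_meas i)).
Qed.

Let GAE V i :
  GA pi0 A V i ord0 = \int[loop_gibbs pi0 V]_q loop_average A q i ord0.
Proof. by rewrite mxE. Qed.

(** The Gibbs measures of V and W are reweightings of [pi0] whose exponents
    differ almost surely by at most e beta. *)
Lemma GA_scale_le V W e i : 0 <= e ->
  (L2Loo_norm (pot_val W \- pot_val V)%R <= e%:E)%E ->
  GA pi0 A V i ord0 + K <= expR (2 * (e * beta)) * (GA pi0 A W i ord0 + K).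
Proof.
move=> e0 WV; rewrite [X in X + K <= _]GAE [X in _ <= _ * (X + K)]GAE.
have K0 : 0 <= K by exact: le_trans (A_le 0 i).
apply: Rintegral_scale_le => // B mB.
have eb0 : 0 <= e * beta by rewrite mulr_ge0// ltW.
apply: (reweight_le eb0 (measurable_potential_int V)
  (measurable_potential_int W)) => //.
have := potential_int_dist e0 WV; apply: filterS => q.
by rewrite distrC.
Qed.

Lemma GA_le V i : `|GA pi0 A V i ord0| <= K.
Proof.
rewrite [X in `|X|]GAE.
have K0 : 0 <= K by exact: le_trans (A_le 0 i).
have PT : (loop_gibbs pi0 V setT < +oo)%E by rewrite probability_setT ltry.
have -> : K = K * fine (loop_gibbs pi0 V setT).
  by rewrite probability_setT mulr1.
apply: normr_Rintegral_le => //.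
by apply: aeW => q _; exact: loop_average_le.
Qed.

(** The superlevel sets are open: by [GA_scale_le], an e with
    exp(2 e beta) (x + K) < G(V) + K is a radius at V for the superlevel set
    at x. *)
Lemma measurable_GA i : measurable_fun [set: W1 R] (fun V => GA pi0 A V i ord0).
Proof.
apply: (measurability _ (RGenOInfty.measurableE R)) => _ [_ [x ->] <-].
rewrite set_itvoy setTI; apply: sub_gen_smallest => V xV.
have {}xV : x < GA pi0 A V i ord0 := xV.
have GVK0 : 0 <= GA pi0 A V i ord0 + K.
  by have := GA_le V i; rewrite ler_norml => /andP[]; lra.
have [e e0 ex] : exists2 e : R, 0 < e &
    expR (2 * (e * beta)) * (x + K) < GA pi0 A V i ord0 + K.
  have [xK|xK] := leP (x + K) 0.
    exists 1 => //; apply: (@le_lt_trans _ _ (1 * (x + K))); last lra.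
    by rewrite ler_wnM2r// -[leLHS]expR0 ler_expR !mulr_ge0// ltW.
  pose r := (GA pi0 A V i ord0 + K) / (x + K).
  have r1 : 1 < r by rewrite /r ltr_pdivlMr// mul1r; lra.
  (* Half of the largest admissible value. *)
  exists (ln r / (4 * beta)); first by rewrite divr_gt0 ?ln_gt0// mulr_gt0.
  rewrite -ltr_pdivlMr// -/r -[ltRHS]lnK ?posrE ?(lt_trans _ r1)// ltr_expR.
  have -> : 2 * (ln r / (4 * beta) * beta) = ln r / 2.
    by field; exact: lt0r_neq0.
  by have := ln_gt0 r1; lra.
exists e; [exact: e0 | move=> W WV].
suff xW : x < GA pi0 A W i ord0 by exact: xW.
have := lt_le_trans ex (GA_scale_le i (ltW e0) (ltW WV)).
by rewrite (ltr_pM2l (expR_gt0 _)) ltrD2r.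
Qed.

End Observables.

(** * The data misfit is Lipschitz in the data *)

Section Misfit.
Context {R : realType} (n : nat).
Implicit Types (S : 'M[R]_n) (v g y : 'cV[R]_n).

Lemma l2norm_ge0 v : 0 <= l2norm v.
Proof. exact: sqrtr_ge0. Qed.

Lemma l2norm_sqr v : l2norm v ^+ 2 = \sum_i v i ord0 ^+ 2.
Proof. by rewrite sqr_sqrtr// sumr_ge0// => i _; rewrite sqr_ge0. Qed.

Lemma l2normN v : l2norm (- v) = l2norm v.
Proof. by congr Num.sqrt; apply: eq_bigr => i _; rewrite mxE sqrrN. Qed.

Lemma entry_le_l2norm v i : `|v i ord0| <= l2norm v.
Proof.
rewrite -sqrtr_sqr ler_sqrt ?sumr_ge0// => [|j _]; last exact: sqr_ge0.
by rewrite (bigD1 i)//= lerDl sumr_ge0// => j _; rewrite sqr_ge0.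
Qed.

Lemma mulmx_entry_le S v (K : R) i : (forall j, `|v j ord0| <= K) ->
  `|(S *m v) i ord0| <= (\sum_j `|S i j|) * K.
Proof.
move=> vK; rewrite mxE mulr_suml.
rewrite (le_trans (ler_norm_sum _ _ _))// ler_sum// => j _.
by rewrite normrM ler_wpM2l.
Qed.

(** [Phi] as a function of the value g of the observable map. *)
Definition misfit S g y : R :=
  2^-1 * l2norm (S *m (y - g)) ^+ 2 - 2^-1 * l2norm (S *m y) ^+ 2.

(** The squares of the entries of S y cancel: the misfit is affine in y. *)
Lemma misfitE S g y : misfit S g y =
  \sum_i (2^-1 * (S *m g) i ord0 ^+ 2 - (S *m y) i ord0 * (S *m g) i ord0).
Proof.
rewrite /misfit !l2norm_sqr !mulr_sumr -sumrB; apply: eq_bigr => i _.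
by rewrite mulmxBr !mxE; field.
Qed.

(** One row sum bounds an entry of S (y1 - y2), the other an entry of S g. *)
Definition misfit_lip S (K : R) : R := \sum_i (\sum_j `|S i j|) ^+ 2 * K.

Lemma misfit_lip_ge0 S K : 0 <= K -> 0 <= misfit_lip S K.
Proof. by move=> K0; rewrite sumr_ge0// => i _; rewrite mulr_ge0// sqr_ge0. Qed.

Lemma misfit_dist_le S g y1 y2 (K : R) : (forall i, `|g i ord0| <= K) ->
  `|misfit S g y1 - misfit S g y2| <= misfit_lip S K * l2norm (y1 - y2).
Proof.
move=> gK; rewrite !misfitE -sumrB mulr_suml.
apply: le_trans (ler_norm_sum _ _ _) _; apply: ler_sum => i _.
have -> : 2^-1 * (S *m g) i ord0 ^+ 2 - (S *m y1) i ord0 * (S *m g) i ord0 -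
    (2^-1 * (S *m g) i ord0 ^+ 2 - (S *m y2) i ord0 * (S *m g) i ord0) =
    - ((S *m (y1 - y2)) i ord0 * (S *m g) i ord0).
  by rewrite mulmxBr [(S *m y1 - _) _ _]mxE [(- (S *m y2)) _ _]mxE; ring.
rewrite normrN normrM.
apply: (@le_trans _ _ (((\sum_j `|S i j|) * l2norm (y1 - y2)) *
    ((\sum_j `|S i j|) * K))).
  by rewrite ler_pM// mulmx_entry_le// => j; exact: entry_le_l2norm.
by rewrite le_eqVlt; apply/orP; left; apply/eqP; ring.
Qed.

Lemma measurable_misfit d (T : measurableType d) S (g : T -> 'cV[R]_n) y :
  (forall i, measurable_fun setT (fun x => g x i ord0)) ->
  measurable_fun setT (fun x => misfit S (g x) y).
Proof.
move=> mg; under eq_fun do rewrite misfitE.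
have mSg i : measurable_fun setT (fun x => (S *m g x) i ord0).
  under eq_fun do rewrite mxE.
  by apply: measurable_sum => j; exact: measurable_funM.
apply: measurable_sum => i; apply: measurable_funB.
  by apply: measurable_funM => //; exact: measurable_funX.
exact: measurable_funM.
Qed.

End Misfit.

Theorem lemma7 (R : realType) (beta M : R) (NT : nat) (theta s : R)
    (gamma : nat -> R) (pi0 : probability (loop beta) R)
    (mu0 : probability (W1 R) R) (A : R -> 'cV[R]_NT) (Gamma : 'M[R]_NT)
    (beta_gt0 : 0 < beta) (M_gt0 : 0 < M)
    (theta_gt0 : 0 < theta) (theta_lt1 : theta < 1)
    (s_gt : Num.max 1 ((theta + 2) / (4 * (1 - theta))) < s)
    (gammaO : gamma =O_\oo (fun i => i%:R `^ (- s)))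
    (pi0P : is_free_loop_measure M pi0)
    (mu0P : is_prior gamma mu0)
    (A_meas : forall i, measurable_fun setT (fun x => A x i ord0))
    (A_bounded : exists K : R, forall x, l2norm (A x) <= K)
    (Gamma_sympd : sym_posdef Gamma) :
  forall r : R, 0 < r -> exists2 C : R, 0 < C &
    forall y1 y2 : 'cV[R]_NT, l2norm y1 < r -> l2norm y2 < r ->
    forall nu : {sigma_finite_measure set (W1 R) -> \bar R},
      posterior pi0 A Gamma mu0 y1 `<< nu ->
      posterior pi0 A Gamma mu0 y2 `<< nu ->
      hellinger nu (posterior pi0 A Gamma mu0 y1)
                   (posterior pi0 A Gamma mu0 y2)
      <= C * l2norm (y1 - y2).
Proof.
move=> r r0; have [K AK] := A_bounded.
have K0 : 0 <= K := le_trans (l2norm_ge0 _) (AK 0).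
have A_le x i : `|A x i ord0| <= K := le_trans (entry_le_l2norm _ _) (AK x).
pose L := misfit_lip (inv_sqrtmx Gamma) K.
have L0 : 0 <= L by exact: misfit_lip_ge0.
(* The constant must be positive, and L may be 0. *)
exists (L + 1); first by rewrite ltr_wpDl.
move=> y1 y2 _ _ nu nu1 nu2.
apply: (@le_trans _ _ (L * l2norm (y1 - y2))); last first.
  by rewrite ler_wpM2r ?l2norm_ge0// lerDl.
have Ly0 : 0 <= L * l2norm (y1 - y2) by rewrite mulr_ge0 ?l2norm_ge0.
have mPhi y : measurable_fun setT (fun V => Phi pi0 A Gamma V y).
  apply: measurable_misfit => i.
  exact: (measurable_GA beta_gt0 pi0P A_meas A_le).
have dPhi V ya yb :
    `|Phi pi0 A Gamma V ya - Phi pi0 A Gamma V yb| <= L * l2norm (ya - yb).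
  by apply: misfit_dist_le => i; exact: (GA_le pi0 beta_gt0 A_meas A_le).
have yC : l2norm (y2 - y1) = l2norm (y1 - y2) by rewrite -opprB l2normN.
apply: (hellinger_le Ly0 nu1 nu2) => B mB.
- apply: (reweight_le Ly0 (mPhi y1) (mPhi y2) _ mB).
  by apply: aeW => V; exact: dPhi.
- apply: (reweight_le Ly0 (mPhi y2) (mPhi y1) _ mB).
  by apply: aeW => V; rewrite -yC; exact: dPhi.
Qed.
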